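(* Let $H$ be a collection of probability measures on a measurable space $\mathcal{X}$, let $Q$ be a probability measure on $\mathcal{X}$ with generalized Lebesgue decomposition $Q=Q_a+Q_s$ with respect to $H$, and let $U:[0,\infty]\to[-\infty,\infty]$ be measurable. Suppose that there exist $\lambda^*\in[0,\infty)$, $P^*\in H^{\mathrm{eff}}$ with $P^*\ll Q_a$, and a valid e-value $\varepsilon^*\in\mathcal{E}(H)$, satisfying $$\varepsilon^*(x)\in\operatorname*{arg\,max}_{z\in[0,\infty)}\left\{U(z)-\lambda^*\frac{dP^*}{dQ_a}(x)\,z\right\},\quad Q_a\text{-a.s.},$$ with $\lambda^*(1-\mathrm{E}^{P^*}[\varepsilon^*])=0$, and suppose that $U(\varepsilon^* )$ is $Q_a$-almost surely finite. Then $\varepsilon^*$ is $U$-optimal.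
   Context: Notation: $\mathrm{E}^\mu[f]=\int f\,d\mu$ for any nonnegative measure $\mu$; Radon--Nikodym derivatives are taken $[0,\infty)$-valued. An event is $H$-negligible if it has probability zero under every $P\in H$. The generalized Lebesgue decomposition of $Q$ with respect to $H$ is $Q=Q_a+Q_s$, where the nonnegative measure $Q_s$ is concentrated on an $H$-negligible event and the nonnegative measure $Q_a$ assigns zero mass to every $H$-negligible event. The class of valid e-values for $H$ is $\mathcal{E}(H)=\{\varepsilon:\mathcal{X}\to[0,\infty]\ \text{measurable}: \mathrm{E}^P[\varepsilon]\le 1\ \text{for all } P\in H\}$. With $M_+$ the collection of nonnegative measures on $\mathcal{X}$, the effective hypothesis is $H^{\mathrm{eff}}=\{P\in M_+: \mathrm{E}^P[\varepsilon]\le 1\ \text{for all } \varepsilon\in\mathcal{E}(H)\}$. A valid e-value $\varepsilon^*\in\mathcal{E}(H)$ is $U$-optimal (against $Q_a$) if, for every $\varepsilon\in\mathcal{E}(H)$, $\mathrm{E}^{Q_a}[U(\varepsilon^* )-U(\varepsilon)]$ is well-defined and $\ge 0$. Here ''well-defined'' means that the integrand avoids an ambiguous $\infty-\infty$ $Q_a$-almost surely, and that its positive part or its negative part has finite $Q_a$-expectation. *)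

(* Defs.v *)
From HB Require Import structures.
From mathcomp Require Import all_boot all_order all_algebra.
From mathcomp Require Import all_classical all_reals all_analysis.
From mathcomp Require Import measurable_realfun.

Set Implicit Arguments.
Unset Strict Implicit.
Unset Printing Implicit Defensive.

Import Order.TTheory GRing.Theory Num.Theory.
Import numFieldNormedType.Exports.

Local Open Scope classical_set_scope.
Local Open Scope ring_scope.
Local Open Scope ereal_scope.

Definition H_negligible (d : measure_display) (T : measurableType d)
    (R : realType) (H : set (probability T R)) (N : set T) : Prop :=
  measurable N /\ forall P : probability T R, H P -> P N = 0.

Definition generalized_Lebesgue_decomposition (d : measure_display)
    (T : measurableType d) (R : realType) (H : set (probability T R))
    (Q : probability T R) (Qa Qs : {measure set T -> \bar R}) : Prop :=
  [/\ forall A : set T, measurable A -> Q A = Qa A + Qs A,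
      exists2 N : set T, H_negligible H N & Qs (~` N) = 0
    & forall N : set T, H_negligible H N -> Qa N = 0].

Definition evalues (d : measure_display) (T : measurableType d)
    (R : realType) (H : set (probability T R)) : set (T -> \bar R) :=
  [set e : T -> \bar R | [/\ measurable_fun setT e, forall x, 0 <= e x
    & forall P : probability T R, H P -> \int[P]_x e x <= 1]].

Definition effective_hypothesis (d : measure_display) (T : measurableType d)
    (R : realType) (H : set (probability T R)) :
    set {measure set T -> \bar R} :=
  [set P | forall e : T -> \bar R, evalues H e -> \int[P]_x e x <= 1].

(* [f] is a version of dP/dmu with values in [0, +oo[. *)
Definition is_RN_derivative (d : measure_display) (T : measurableType d)
    (R : realType) (P mu : {measure set T -> \bar R}) (f : T -> R) : Prop :=
  [/\ measurable_fun setT f, forall x, (0 <= f x)%R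
    & forall A : set T, measurable A -> P A = \int[mu]_(x in A) (f x)%:E].

Definition argmax (X : Type) (R : realType) (D : set X) (g : X -> \bar R) :
    set X :=
  [set z | D z /\ forall w, D w -> g w <= g z].

(* [u +? - v] says that u - v is not of the form oo - oo.  The library's
   total subtraction gives such differences a default value, which the
   first clause confines to a mu-null set. *)
Definition expectation_diff_welldefined (d : measure_display)
    (T : measurableType d) (R : realType) (mu : {measure set T -> \bar R})
    (u v : T -> \bar R) : Prop :=
  {ae mu, forall x, u x +? - v x} /\
  (\int[mu]_x ((fun y => u y - v y)^\+ x) < +oo \/
   \int[mu]_x ((fun y => u y - v y)^\- x) < +oo).

Definition U_optimal (d : measure_display) (T : measurableType d)
    (R : realType) (H : set (probability T R))
    (Qa : {measure set T -> \bar R}) (U : \bar R -> \bar R)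
    (es : T -> \bar R) : Prop :=
  evalues H es /\
  forall e : T -> \bar R, evalues H e ->
    expectation_diff_welldefined Qa (U \o es) (U \o e) /\
    0 <= \int[Qa]_x (U (es x) - U (e x)).

(* Main.v *)
Require Import Defs.
From HB Require Import structures.
From mathcomp Require Import all_boot all_order all_algebra.
From mathcomp Require Import all_classical all_reals all_analysis.
From mathcomp Require Import measurable_realfun.
From mathcomp Require Import lra.

Set Implicit Arguments.
Unset Strict Implicit.
Unset Printing Implicit Defensive.

Import Order.TTheory GRing.Theory Num.Theory.
Import numFieldNormedType.Exports.
Import HBNNSimple.

Local Open Scope classical_set_scope.
Local Open Scope ring_scope.
Local Open Scope ereal_scope.


(** The theorem is weak Lagrangian duality, integrated. Write
    [g := U es - U e] for a competing e-value [e] and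
    [cost z := lambda * f * z] for the price paid for a payoff [z].
    Maximality of [es x] in the pointwise Lagrangian gives
    [U (e x) - cost e x <= U (es x) - cost es x] wherever [e x] is finite, that
    is, [cost es - cost e <= g]. Finiteness of [e] holds Qa-almost surely
    because the event [e = +oo] is H-negligible ([evalue_ae_fin]).

    Integrating against Qa turns the costs into expectations under P
    ([integral_RN]): [cost e] has integral [lambda * E^P e <= lambda], because
    P is in the effective hypothesis, while [cost es] has integral exactly
    [lambda], by complementary slackness. So the integral of [g] is bounded
    below by a nonnegative number.

    Since [U e] may be [-oo] and neither [U es] nor [U e] need be integrable,
    the inequality is never integrated in the form [cost es - cost e <= g]:
    it is first rearranged to [cost es + g^\- <= g^\+ + cost e], all of whose
    terms are nonnegative ([lee_pos_neg_parts], [integral_diff_ge0]). That form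
    also shows that [g^\-] is integrable, so the expectation of [g] is
    well-defined. *)

(** The event [e = +oo] has probability zero under each member of [H], as [e]
    is integrable there; a measure that ignores H-negligible events therefore
    ignores it too. *)
Lemma evalue_ae_fin (d : measure_display) (T : measurableType d)
    (R : realType) (H : set (probability T R)) (mu : {measure set T -> \bar R})
    (e : T -> \bar R) :
  (forall N, H_negligible H N -> mu N = 0) -> evalues H e ->
  {ae mu, forall x, e x \is a fin_num}.
Proof.
move=> muH [me e0 eH].
have mN : measurable (e @^-1` [set +oo]).
  by rewrite -[X in measurable X]setTI; exact: me (emeasurable_set1 _).
have eN : H_negligible H (e @^-1` [set +oo]).
  split=> // P0 HP0.
  have /(integrable_ae measurableT) : P0.-integrable setT e.
    apply/integrableP; split=> //.
    under eq_integral do rewrite gee0_abs//.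
    by rewrite (le_lt_trans (eH _ HP0)) ?ltry.
  move=> eae; apply/(negligibleP P0 mN).
  apply: negligibleS eae => x /= ex /(_ I).
  by rewrite ex.
exists (e @^-1` [set +oo]); split=> //; first exact: muH.
by move=> x /=; have := e0 x; case: (e x).
Qed.

(** Splitting [h] along its finitely many level sets reduces the identity to the
    defining property of the density on each of them. *)
Lemma integral_nnsfun_RN (d : measure_display) (T : measurableType d)
    (R : realType) (P mu : {measure set T -> \bar R}) (f : T -> R)
    (h : {nnsfun T >-> R}) :
  is_RN_derivative P mu f ->
  \int[P]_x (h x)%:E = \int[mu]_x ((h x)%:E * (f x)%:E).
Proof.
move=> [mf f0 PE]; rewrite integralT_nnsfun sintegralE.
have mfE : measurable_fun setT (EFin \o f) by exact/measurable_EFinP.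
have f0E x : 0 <= (EFin \o f) x by rewrite lee_fin.
have mA y : measurable (h @^-1` [set y]) by exact: measurable_funPTI.
have mg y : measurable_fun setT ((EFin \o f) \_ (h @^-1` [set y])).
  apply/(measurable_restrictT _ (mA y)); exact: measurable_funTS.
have g0 y x : 0 <= ((EFin \o f) \_ (h @^-1` [set y])) x.
  by rewrite patchE; case: ifP.
have rng y : range h y -> 0 <= y%:E by case=> x _ <-; rewrite lee_fin.
transitivity (\int[mu]_x \sum_(y \in range h)
    (y%:E * ((EFin \o f) \_ (h @^-1` [set y])) x)); last first.
  apply: eq_integral => x _.
  rewrite (fsbigD1 (h x))//=; last by exists x.
  rewrite patchE mem_set//= -[RHS]adde0; congr (_ + _).
  apply: fsbig1 => y [_ /= yhx].
  by rewrite patchE memNset ?mule0//= => hxy; apply: yhx.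
(* Linearity of the integral of a nonnegative sum asks each summand to be
   nonnegative for every index, not only for those in the range of h; clipping
   the coefficient y at 0 provides this and changes nothing on the range. *)
under [RHS]eq_integral => x _.
  rewrite (eq_fsbigr (fun y =>
     maxe y%:E 0 * ((EFin \o f) \_ (h @^-1` [set y])) x)); first over.
  by move=> y /set_mem /rng y0; rewrite max_l.
rewrite ge0_integral_fsum//; last 2 first.
- by move=> y; apply: emeasurable_funM.
- by move=> y x _; rewrite mule_ge0// le_max lexx orbT.
apply: eq_fsbigr => y /set_mem /rng y0; rewrite max_l//.
by rewrite ge0_integralZl// PE// integral_mkcond.
Qed.

(** Monotone convergence along simple functions increasing to [e]; the value of
    the density being finite is what makes [h n x * f x] converge to
    [e x * f x] even where [e x] is infinite. *)
Lemma integral_RN (d : measure_display) (T : measurableType d)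
    (R : realType) (P mu : {measure set T -> \bar R}) (f : T -> R)
    (e : T -> \bar R) :
  is_RN_derivative P mu f -> measurable_fun setT e -> (forall x, 0 <= e x) ->
  \int[P]_x e x = \int[mu]_x (e x * (f x)%:E).
Proof.
move=> Pf me e0; have [mf f0 _] := Pf.
pose h := nnsfun_approx measurableT me.
have he x : (h n x)%:E @[n --> \oo] --> e x.
  exact: (cvg_nnsfun_approx measurableT me (fun x _ => e0 x)).
have hnd x : {homo (fun n => h n x) : m n / (m <= n)%N >-> (m <= n)%R}.
  by move=> m n mn; exact/lefP/nd_nnsfun_approx.
have mh n : measurable_fun setT (fun x => (h n x)%:E).
  exact/measurable_EFinP.
transitivity (limn (fun n => \int[P]_x (h n x)%:E)).
  rewrite -monotone_convergence//.
  - by apply: eq_integral => x _; exact/esym/cvg_lim.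
  - by move=> n x _; rewrite lee_fin.
  - by move=> x _ m n mn; rewrite lee_fin hnd.
under eq_fun do rewrite (integral_nnsfun_RN _ Pf).
rewrite -monotone_convergence//.
- by apply: eq_integral => x _; apply/cvg_lim => //; exact: cvgeZr.
- by move=> n; apply: emeasurable_funM => //; exact/measurable_EFinP.
- by move=> n x _; rewrite mule_ge0 ?lee_fin.
- by move=> x _ m n mn; rewrite lee_wpmul2r ?lee_fin ?hnd.
Qed.

(** The Lagrangian inequality rearranged so that both sides are sums of
    nonnegative terms when [a] and [b] are. The value [v = -oo] is allowed, and
    makes the right-hand side infinite. *)
Lemma lee_pos_neg_parts (R : realType) (u v a b : \bar R) :
  u \is a fin_num -> a \is a fin_num -> b \is a fin_num ->
  v - b <= u - a ->
  v != +oo /\ a + maxe (- (u - v)) 0 <= maxe (u - v) 0 + b.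
Proof.
case: u => [u| |]// _; case: a => [a| |]// _; case: b => [b| |]// _.
case: v => [v| |]//=; last first.
  by rewrite /= !maxNye !maxye; split; rewrite // leey.
rewrite -!EFinB -!EFin_max -!EFinD !lee_fin => vbua; split=> //.
by case: (lerP (u - v) 0) => ?; case: (lerP (- (u - v)) 0) => ?; lra.
Qed.

(** An integral comparison for a [g] that is not assumed integrable. Where [g]
    is negative its positive part vanishes, so the hypothesis bounds [g^\-] by
    [b] and hence makes it integrable; integrating the hypothesis and cancelling
    the finite integral of [b] then compares the two parts of [g]. *)
Lemma integral_diff_ge0 (d : measure_display) (T : measurableType d)
    (R : realType) (mu : {measure set T -> \bar R}) (g a b : T -> \bar R) :
  measurable_fun setT g -> measurable_fun setT a -> measurable_fun setT b ->
  (forall x, 0 <= a x) -> (forall x, 0 <= b x) ->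
  {ae mu, forall x, a x + g^\- x <= g^\+ x + b x} ->
  \int[mu]_x b x <= \int[mu]_x a x -> \int[mu]_x b x < +oo ->
  \int[mu]_x g^\- x < +oo /\ 0 <= \int[mu]_x g x.
Proof.
move=> mg ma mb a0 b0 gab ba boo.
have mgp := measurable_funepos mg; have mgn := measurable_funeneg mg.
have gnoo : \int[mu]_x g^\- x < +oo.
  apply: le_lt_trans boo; apply: ae_ge0_le_integral => //.
  apply: filterS gab => x /= gabx _.
  have [gx0|gx0] := leP 0 (g x).
    by rewrite funenegE max_r ?oppe_le0.
  have gp : g^\+ x = 0 by rewrite funeposE max_r// ltW.
  move: gabx; rewrite gp add0e.
  by apply: le_trans; rewrite leeDr.
split=> //; rewrite integralE sube_ge0; last first.
  by rewrite ge0_fin_numE ?integral_ge0// gnoo.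
have : \int[mu]_x (a x + g^\- x) <= \int[mu]_x (g^\+ x + b x).
  apply: ae_ge0_le_integral => //.
  - by move=> x _; rewrite adde_ge0.
  - exact: emeasurable_funD.
  - by move=> x _; rewrite adde_ge0.
  - exact: emeasurable_funD.
  - by apply: filterS gab.
rewrite !ge0_integralD// => le1.
have bfin : \int[mu]_x b x \is a fin_num by rewrite ge0_fin_numE// integral_ge0.
rewrite -(leeD2rE _ _ bfin).
by apply: le_trans le1; rewrite [leRHS]addeC leeD2l.
Qed.

Theorem theorem3 (d : measure_display) (T : measurableType d) (R : realType)
    (H : set (probability T R)) (Q : probability T R)
    (Qa Qs : {measure set T -> \bar R})
    (hQ : generalized_Lebesgue_decomposition H Q Qa Qs)
    (U : \bar R -> \bar R)
    (mU : measurable_fun [set z : \bar R | 0 <= z] U)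
    (lambda : R) (lambda_ge0 : (0 <= lambda)%R)
    (P : {measure set T -> \bar R}) (hP : effective_hypothesis H P)
    (PQa : P `<< Qa)
    (es : T -> \bar R) (hes : evalues H es)
    (f : T -> R) (hf : is_RN_derivative P Qa f)
    (hargmax : {ae Qa, forall x,
       argmax [set z : \bar R | 0 <= z < +oo]
         (fun z => U z - (lambda * f x)%:E * z) (es x)})
    (hslack : lambda%:E * (1 - \int[P]_x es x) = 0)
    (hfin : {ae Qa, forall x, U (es x) \is a fin_num}) :
  U_optimal H Qa U es.
Proof.
split=> // e he; have [mes es0 _] := hes; have [me e0 _] := he.
have [_ _ QaH] := hQ; have [mf f0 _] := hf.
have mUc z : measurable_fun setT z -> (forall x, 0 <= z x) ->
    measurable_fun setT (U \o z).
  move=> mz z0; apply: (measurable_comp _ _ mU mz); last first.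
    by move=> _ [x _ <-]; exact: z0.
  by rewrite -set_itvcy; exact: emeasurable_itv.
pose g x := U (es x) - U (e x).
have mg : measurable_fun setT g.
  by apply: emeasurable_funB; exact: mUc.
pose cost (z : T -> \bar R) x := (lambda * f x)%:E * z x.
have cost0 z x : (forall y, 0 <= z y) -> 0 <= cost z x.
  by move=> z0; rewrite mule_ge0// lee_fin mulr_ge0.
have mcost z : measurable_fun setT z -> measurable_fun setT (cost z).
  move=> mz; apply: emeasurable_funM => //.
  by apply/measurable_EFinP; exact: measurable_funM.
have costE z : measurable_fun setT z -> (forall y, 0 <= z y) ->
    \int[Qa]_x cost z x = lambda%:E * \int[P]_x z x.
  move=> mz z0; rewrite (integral_RN hf)// -ge0_integralZl//.
  - by apply: eq_integral => x _; rewrite /cost EFinM -muleA [z x * _]muleC.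
  - by apply: emeasurable_funM => //; exact/measurable_EFinP.
  - by move=> x _; rewrite mule_ge0 ?lee_fin.
have coste : \int[Qa]_x cost e x <= lambda%:E.
  by rewrite costE// -[leRHS]mule1 lee_wpmul2l ?lee_fin// hP.
(* For lambda > 0, slackness forces E^P es = 1; for lambda = 0 both sides
   vanish. A real value of E^P es lets the slackness equation be expanded. *)
have costes : \int[Qa]_x cost es x = lambda%:E.
  rewrite costE//; have Pes1 : \int[P]_x es x <= 1 by exact: hP.
  have : \int[P]_x es x \is a fin_num.
    rewrite ge0_fin_numE ?integral_ge0//.
    by rewrite (le_lt_trans Pes1) ?ltry.
  move: hslack; case: (\int[P]_x es x) => // r + _.
  rewrite -EFinB -!EFinM => -[/eqP].
  by rewrite mulrBr mulr1 subr_eq0 => /eqP <-.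
have key : {ae Qa, forall x, U (e x) != +oo /\
    cost es x + g^\- x <= g^\+ x + cost e x}.
  apply: filterS3 (evalue_ae_fin QaH he) hargmax hfin => x ex [/=].
  move=> /andP[_ esoo] opt Ues; rewrite funeposE funenegE /cost /g.
  have esx : es x \is a fin_num by rewrite ge0_fin_numE.
  apply: lee_pos_neg_parts; rewrite ?fin_numM//.
  by apply: opt; rewrite e0 -ge0_fin_numE.
have [gnoo gint] : \int[Qa]_x g^\- x < +oo /\ 0 <= \int[Qa]_x g x.
  apply: (integral_diff_ge0 mg (mcost _ mes) (mcost _ me)).
  - by move=> x; exact: cost0.
  - by move=> x; exact: cost0.
  - by apply: filterS key => x [].
  - by rewrite costes.
  - by rewrite (le_lt_trans coste) ?ltry.
split=> //; split; last by right.
apply: filterS2 key hfin => x [Ue _] Ues.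
exact: fin_num_adde_defr.
Qed.
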